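(* Let $f:\mathbb{R}^n\to\mathbb{R}$, let $\bar A_i\in\mathbb{R}^{k_i\times n}$, $\bar b_i\in\mathbb{R}^{k_i}$, $Q_i\subset\mathbb{R}^{k_i}$ and uncertainty sets $\Delta\mathcal{U}_i\subset\mathbb{R}^{k_i\times n}\times\mathbb{R}^{k_i}$ with $(0,0)\in\Delta\mathcal{U}_i$ be given for $1\le i\le m$. Let $\Phi=\{x\in\mathbb{R}^n\mid \bar A_i x-\bar b_i\in Q_i \text{ for all } 1\le i\le m\}$, and let $\bar x$ be a solution of the nominal problem $\min\{f(x)\mid x\in\Phi\}$. For $\epsilon>0$ consider the robust optimization problem $$(\mathrm{R}_\epsilon)\qquad \min_x\ f(x)\quad\text{s.t. } [\bar A_i+\Delta A_i]x-[\bar b_i+\Delta b_i]\in Q_i\ \text{ for all }(\Delta A_i,\Delta b_i)\in\epsilon\,\Delta\mathcal{U}_i\text{ and all } i,$$ and the tangential problem $$(\mathrm{T})\qquad \min_\gamma\ df(\bar x)(\gamma)\quad\text{s.t. } \bar A_i\gamma+[(\Delta A_i)\bar x-\Delta b_i]\in T_{Q_i}(\bar A_i\bar x-\bar b_i)\ \text{ for all }(\Delta A_i,\Delta b_i)\in\Delta\mathcal{U}_i\text{ and all } i.$$ Let $\bar\Gamma$ be the set of optimal solutions of $(\mathrm{T})$. Suppose: (1) each $Q_i$ is a closed set that is Clarke regular at $\bar A_i\bar x-\bar b_i$; (2) each $\Delta\mathcal{U}_i$ is a compact convex set; (3) $\bar\Gamma$ is bounded; (4) there is some $\gamma'\in\mathbb{R}^n$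 such that $\bar A_i\gamma'\in\operatorname{int}\big(T_{Q_i}(\bar A_i\bar x-\bar b_i)\big)$ for all $i$; (5) (compactness) if $\{x_j\}\subset\Phi$ is a sequence with $f(x_j)\to f(\bar x)$, then $x_j\to\bar x$; (6) $f$ is locally Lipschitz and subdifferentially regular at $\bar x$. Then the set of cluster points of any sequence $\{\frac{1}{\epsilon}(\bar x_\epsilon-\bar x)\}$, where $\bar x_\epsilon$ is an optimal solution of $(\mathrm{R}_\epsilon)$ and $\epsilon\searrow 0$ (along a sequence), is a subset of $\bar\Gamma$. The optimal objective value $\bar v_\epsilon$ of $(\mathrm{R}_\epsilon)$ satisfies $\bar v_\epsilon=\bar v+\epsilon\tilde v+o(\epsilon)$ as $\epsilon\searrow0$, where $\bar v=f(\bar x)$ and $\tilde v$ is the optimal objective value of $(\mathrm{T})$. In particular, if $\bar\Gamma$ contains only one element, say $\bar\gamma$, then $\lim_{\epsilon\searrow0}\frac1\epsilon(\bar x_\epsilon-\bar x)=\bar\gamma$, that is, $\bar x_\epsilon\in\bar x+\epsilon\bar\gamma+o(\epsilon)$.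
   Context: For $C\subset\mathbb{R}^p$ and $\bar y\in C$: the tangent cone is $T_C(\bar y)=\{w\mid (y_j-\bar y)/t_j\to w \text{ for some } y_j\in C,\ y_j\to\bar y,\ t_j\searrow0\}$. A vector $v$ is a regular normal, $v\in\hat N_C(\bar y)$, if $v^T(y-\bar y)\le o(|y-\bar y|)$ for all $y\in C$; $v$ is a normal, $v\in N_C(\bar y)$, if there are $y_j\to\bar y$ with $y_j\in C$ and $v_j\to v$ with $v_j\in\hat N_C(y_j)$. $C$ is Clarke regular at $\bar y$ if $N_C(\bar y)=\hat N_C(\bar y)$. For $f$ locally Lipschitz at $\bar x$, the subderivative is $df(\bar x)(w)=\liminf_{\tau\searrow0}\frac{f(\bar x+\tau w)-f(\bar x)}{\tau}$ and the regular subderivative is $\hat df(\bar x)(w)=\limsup_{\tau\searrow0,\,x\to\bar x}\frac{f(x+\tau w)-f(x)}{\tau}$. $f$ is subdifferentially regular at $\bar x$ if $df(\bar x)=\hat df(\bar x)$ (equivalently, the epigraph of $f$ is Clarke regular at $(\bar x,f(\bar x))$). Here $\epsilon\,\Delta\mathcal{U}_i=\{\epsilon u\mid u\in\Delta\mathcal{U}_i\}$. The sets $\Delta\mathcal{U}_i$ are translations, by the nominal data $(\bar A_i,\bar b_i)$, of uncertainty sets containing the nominal data, so they contain the origin.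
   Formalization: The value expansion is stated under the added assumption that the set of optimal solutions of (T) is nonempty (as well as bounded); if (T) does not attain its minimum, this set is empty, hence bounded, and the expansion can fail. *)

(* Defs.v *)
From HB Require Import structures.
From mathcomp Require Import all_boot all_order all_algebra.
From mathcomp Require Import all_classical all_reals all_analysis.

Set Implicit Arguments.
Unset Strict Implicit.
Unset Printing Implicit Defensive.

Import Order.TTheory GRing.Theory Num.Theory.
Import numFieldNormedType.Exports.

Local Open Scope classical_set_scope.
Local Open Scope ring_scope.

(* Vectors carry the max norm of MathComp-Analysis. All notions below depend
   on the norm only up to equivalence, so this agrees with the Euclidean norm. *)

Section VariationalGeometry.
Variables (R : realType) (p : nat).
Implicit Types (C : set 'cV[R]_p) (ybar : 'cV[R]_p).

(* "t_j decreases to 0" is read as t_j > 0 and t_j --> 0; requiring monotonicity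
   gives the same cone, by passing to subsequences. *)
Definition tangent_cone C ybar : set 'cV[R]_p :=
  [set w | exists (y : nat -> 'cV[R]_p) (t : nat -> R),
    [/\ forall j, C (y j),
        y @ \oo --> ybar,
        forall j, 0 < t j,
        t @ \oo --> 0
      & ((t j)^-1 *: (y j - ybar)) @[j --> \oo] --> w]].

Definition regular_normal_cone C ybar : set 'cV[R]_p :=
  [set v | forall e : R, 0 < e ->
    \forall y \near within C (nbhs ybar),
      (v^T *m (y - ybar)) 0 0 <= e * `|y - ybar|].

Definition normal_cone C ybar : set 'cV[R]_p :=
  [set v | exists y_ v_ : nat -> 'cV[R]_p,
    [/\ forall j, C (y_ j),
        y_ @ \oo --> ybar,
        forall j, regular_normal_cone C (y_ j) (v_ j)
      & v_ @ \oo --> v]].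

Definition clarke_regular C ybar :=
  normal_cone C ybar = regular_normal_cone C ybar.

End VariationalGeometry.

Section Subderivatives.
Variables (R : realType) (n : nat) (f : 'cV[R]_n -> R) (xbar : 'cV[R]_n).

Definition locally_lipschitz_at := lipschitz_on f (nbhs (xbar, xbar)).

Definition subderivative (w : 'cV[R]_n) : \bar R :=
  limf_einf (fun tau : R => ((f (xbar + tau *: w) - f xbar) / tau)%:E) (0^'+).

Definition regular_subderivative (w : 'cV[R]_n) : \bar R :=
  limf_esup
    (fun z : R * 'cV[R]_n => ((f (z.2 + z.1 *: w) - f z.2) / z.1)%:E)
    (filter_prod (0^'+) (nbhs xbar)).

Definition subdifferentially_regular :=
  subderivative = regular_subderivative.

End Subderivatives.

Section Minimization.
Variables (R : realType) (T : Type) (D : set T) (g : T -> \bar R).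

Definition argmin : set T :=
  [set x | D x /\ forall y, D y -> (g x <= g y)%E].

Definition optimal_value : \bar R := ereal_inf (g @` D).

End Minimization.

Definition nominal_feasible (R : realType) (n m : nat) (k : 'I_m -> nat)
    (A : forall i, 'M[R]_(k i, n)) (b : forall i, 'cV[R]_(k i))
    (Q : forall i, set 'cV[R]_(k i)) : set 'cV[R]_n :=
  [set x | forall i, Q i (A i *m x - b i)].

Definition robust_feasible (R : realType) (n m : nat) (k : 'I_m -> nat)
    (A : forall i, 'M[R]_(k i, n)) (b : forall i, 'cV[R]_(k i))
    (Q : forall i, set 'cV[R]_(k i))
    (dU : forall i, set ('M[R]_(k i, n) * 'cV[R]_(k i)))
    (eps : R) : set 'cV[R]_n :=
  [set x | forall i, forall u, [set eps *: d | d in dU i] u ->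
    Q i ((A i + u.1) *m x - (b i + u.2))].

Definition tangential_feasible (R : realType) (n m : nat) (k : 'I_m -> nat)
    (A : forall i, 'M[R]_(k i, n)) (b : forall i, 'cV[R]_(k i))
    (Q : forall i, set 'cV[R]_(k i))
    (dU : forall i, set ('M[R]_(k i, n) * 'cV[R]_(k i)))
    (xbar : 'cV[R]_n) : set 'cV[R]_n :=
  [set gamma | forall i, forall u, dU i u ->
    tangent_cone (Q i) (A i *m xbar - b i)
      (A i *m gamma + (u.1 *m xbar - u.2))].

(* Main.v *)
(* If N_C(ybar) = \hat N_C(ybar), a direction w making a negative product with
   every nonzero normal can be followed from ybar inside C, together with all
   nearby directions; hence T_C(ybar) is the polar of N_C(ybar) as soon as it has
   interior, and adding a multiple of the Slater direction to a solution of (T)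
   gives a direction along which xbar moves inside the feasible set of (R_eps),
   uniformly over the compact uncertainty sets. This bounds the value of (R_eps)
   from above.

   Conversely, limits of the rescaled displacements (x_eps - xbar) / eps of
   near-optimal points are feasible for (T). Such displacements stay bounded: if
   not, their normalized limit d satisfies A_i d \in T_{Q_i} and df(d) <= 0, so
   Gamma would contain the ray through d, by sublinearity of df and convexity of
   the tangent cones. *)
Require Import Defs.
From HB Require Import structures.
From mathcomp Require Import all_boot all_order all_algebra.
From mathcomp Require Import all_classical all_reals all_analysis.
From mathcomp Require Import ring lra.

Set Implicit Arguments.
Unset Strict Implicit.
Unset Printing Implicit Defensive.

Import Order.TTheory GRing.Theory Num.Theory.
Import numFieldNormedType.Exports.

Local Open Scope classical_set_scope.
Local Open Scope ring_scope.

(** * Sequences and norms of matrices *)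

Section Sequences.
Variables (R : realType) (V : normedModType R).

Lemma cvg_ge_id (phi : nat -> nat) :
  (forall k, (k <= phi k)%N) -> phi @ \oo --> \oo.
Proof.
move=> phi_ge A [N _ NA]; exists N => // k /= Nk.
by apply: NA => /=; exact: leq_trans (phi_ge k).
Qed.

Lemma cvg_of_harmonic (u : nat -> V) (l : V) :
  (forall j, `|l - u j| < j.+1%:R^-1) -> u @ \oo --> l.
Proof.
move=> ul; apply/cvgrPdist_lt => e e0.
near=> j; apply: lt_trans (ul j) _.
near: j; exact: (near_infty_natSinv_lt (PosNum e0)).
Unshelve. all: by end_near. Qed.

(** Every tail of [u] meets every ball around [l], which yields the index [phi k]. Such a [phi] need
    not be increasing; [k <= phi k] suffices to carry limits along it. *)
Lemma cluster_subseq (u : nat -> V) (l : V) : cluster (u @ \oo) l ->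
  exists2 phi : nat -> nat, (forall k, (k <= phi k)%N) & u \o phi @ \oo --> l.
Proof.
move=> ul; have /choice[phi phiP] : forall k, exists j,
    (k <= j)%N /\ `|l - u j| < k.+1%:R^-1.
  move=> k.
  have Fk : (u @ \oo) [set u j | j in [set j | (k <= j)%N]].
    by exists k => // j /= kj; exists j.
  have Bk : nbhs l (ball l (k.+1%:R^-1)).
    by apply: nbhsx_ballx; rewrite invr_gt0.
  have [_ [[j /= kj <-] ujk]] := ul _ _ Fk Bk.
  by exists j; split=> //; move: ujk; rewrite -ball_normE.
exists phi => [k|]; first by have [] := phiP k.
by apply: cvg_of_harmonic => k; have [] := phiP k.
Qed.

End Sequences.

Section MatrixNorm.
Variable R : realType.

Lemma mx_coord_norm_le p q (M : 'M[R]_(p, q)) i j : `|M i j| <= `|M|.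
Proof.
rewrite [leRHS]/Num.Def.normr/= mx_normrE.
by apply/bigmax_geP; right; exists (i, j).
Qed.

Lemma mx_norm_leP p q (M : 'M[R]_(p, q)) c : 0 <= c ->
  (forall i j, `|M i j| <= c) -> `|M| <= c.
Proof.
move=> c0 Mc; rewrite [leLHS]/Num.Def.normr/= mx_normrE.
by apply: bigmax_le => // -[i j] _; exact: Mc.
Qed.

Lemma mulmx_norm_le p q r (M : 'M[R]_(p, q)) (v : 'M[R]_(q, r)) :
  `|M *m v| <= q%:R * (`|M| * `|v|).
Proof.
apply: mx_norm_leP => [|i j]; first by rewrite !mulr_ge0.
rewrite mxE; apply: le_trans (ler_norm_sum _ _ _) _.
apply: (@le_trans _ _ (\sum_(k < q) `|M| * `|v|)).
  apply: ler_sum => k _; rewrite normrM.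
  by apply: ler_pM => //; exact: mx_coord_norm_le.
by rewrite sumr_const card_ord mulr_natl.
Qed.

Lemma cvg_mulmx (T : Type) (F : set_system T) {FF : Filter F} p q r
    (M_ : T -> 'M[R]_(p, q)) (v_ : T -> 'M[R]_(q, r))
    (M : 'M[R]_(p, q)) (v : 'M[R]_(q, r)) :
  M_ @ F --> M -> v_ @ F --> v -> (M_ x *m v_ x) @[x --> F] --> M *m v.
Proof.
move=> M_M v_v.
have bound x : `|M *m v - M_ x *m v_ x| <=
    q%:R * (`|M - M_ x| * `|v_ x| + `|M| * `|v - v_ x|).
  have -> : M *m v - M_ x *m v_ x = (M - M_ x) *m v_ x + M *m (v - v_ x).
    rewrite mulmxBl mulmxBr [RHS]addrC addrA; congr (_ - _).
    by rewrite subrK.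
  rewrite mulrDr; apply: le_trans (ler_normD _ _) _.
  by apply: lerD; exact: mulmx_norm_le.
have cvg0 : q%:R * (`|M - M_ x| * `|v_ x| + `|M| * `|v - v_ x|)
    @[x --> F] --> (0 : R).
  have -> : 0 = q%:R * (`|M - M| * `|v| + `|M| * `|v - v|).
    by rewrite !subrr !normr0 mul0r mulr0 addr0 mulr0.
  apply: cvgM; first exact: cvg_cst.
  apply: cvgD; apply: cvgM.
  - by apply: cvg_norm; apply: cvgB => //; exact: cvg_cst.
  - exact: cvg_norm.
  - exact: cvg_cst.
  - by apply: cvg_norm; apply: cvgB => //; exact: cvg_cst.
apply/cvgrPdist_lt => e e0.
have /cvgr0Pnorm_lt /(_ _ e0) := cvg0; apply: filterS => x.
by move=> /(le_lt_trans (ler_norm _)); exact: le_lt_trans.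
Qed.

Lemma trmx_continuous p q : continuous (@trmx R p q).
Proof.
move=> M; apply/(@cvgrPdist_le _ _ _ (nbhs M) (nbhs_filter M)) => e e0.
have /(@cvgrPdist_le _ _ _ _ (nbhs_filter M)) /(_ _ e0) := @cvg_id _ (nbhs M).
apply: filterS => N MN; apply: mx_norm_leP => [|i j]; first exact: ltW.
by apply: le_trans MN; have := mx_coord_norm_le (M - N) j i; rewrite !mxE.
Qed.

(** Heine-Borel for row vectors is carried over by transposition, which is continuous and preserves
    the max norm. *)
Lemma bounded_closed_compact_cV p (K : set 'cV[R]_p) :
  bounded_set K -> closed K -> compact K.
Proof.
move=> Kb Kc; have -> : K = trmx @` (trmx @^-1` K).
  apply/seteqP; split=> [v Kv|_ [v Kv <-]//].
  by exists v^T; rewrite /= ?trmxK.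
apply: continuous_compact.
  by apply: continuous_subspaceT; exact: trmx_continuous.
apply: bounded_closed_compact; last first.
  apply: closed_comp => //.
  by move=> x _; exact: trmx_continuous.
have [M [Mr MK]] := Kb; exists M; split=> // c Mc v /(MK _ Mc) /= vc.
have c0 : 0 <= c by exact: le_trans vc.
apply: mx_norm_leP => // i j.
by apply: le_trans vc; have := mx_coord_norm_le v^T j i; rewrite mxE.
Qed.

Lemma bounded_subseq p (u : nat -> 'cV[R]_p) (c : R) :
  (forall j, `|u j| <= c) ->
  exists2 phi : nat -> nat, (forall k, (k <= phi k)%N) &
    exists l : 'cV[R]_p, u \o phi @ \oo --> l.
Proof.
move=> uc; pose K := [set v : 'cV[R]_p | `|v| <= c].
have Kc : compact K.
  apply: bounded_closed_compact_cV.
    exists c; split; first exact: num_real.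
    by move=> d cd v /= /le_trans; apply; exact: ltW.
  rewrite (_ : K = (fun v : 'cV[R]_p => `|v|) @^-1` [set x | x <= c])//.
  apply: closed_comp; last exact: closed_le.
  by move=> x _; exact: norm_continuous.
have [|l [_ /cluster_subseq[phi phi_ge ul]]] := Kc (u @ \oo) _.
  by exists 0%N => // j _; exact: uc.
by exists phi => //; exists l.
Qed.

End MatrixNorm.

(** * Tangent cones and regular normals *)

Section DotProduct.
Variables (R : realType) (p : nat).
Implicit Types u v w : 'cV[R]_p.

(** [dot v v] is the squared Euclidean length, whereas |v| is the max norm. Projections are taken
    with respect to [dot], since their residuals must be normals. *)
Definition dot u v : R := (u^T *m v) 0 0.

Lemma dotE u v : dot u v = \sum_i u i 0 * v i 0.
Proof. by rewrite /dot mxE; apply: eq_bigr => i _; rewrite mxE. Qed.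

Lemma dotC u v : dot u v = dot v u.
Proof. by rewrite !dotE; apply: eq_bigr => i _; rewrite mulrC. Qed.

Lemma dotDr u v w : dot u (v + w) = dot u v + dot u w.
Proof. by rewrite /dot mulmxDr mxE. Qed.

Lemma dotZr a u v : dot u (a *: v) = a * dot u v.
Proof. by rewrite /dot -scalemxAr mxE. Qed.

Lemma dotDl u v w : dot (u + v) w = dot u w + dot v w.
Proof. by rewrite dotC dotDr !(dotC w). Qed.

Lemma dotZl a u v : dot (a *: u) v = a * dot u v.
Proof. by rewrite dotC dotZr dotC. Qed.

Lemma dotNl u v : dot (- u) v = - dot u v.
Proof. by rewrite -scaleN1r dotZl mulN1r. Qed.

Lemma dotNr u v : dot u (- v) = - dot u v.
Proof. by rewrite dotC dotNl dotC. Qed.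

Lemma dot_sqrD u v : dot (u + v) (u + v) = dot u u + 2 * dot u v + dot v v.
Proof. by rewrite dotDl !dotDr (dotC v); ring. Qed.

Lemma dot_norm_le u v : `|dot u v| <= p%:R * (`|u| * `|v|).
Proof.
apply: le_trans (mx_coord_norm_le _ _ _) _.
apply: le_trans (mulmx_norm_le _ _) _.
rewrite ler_wpM2l// ler_wpM2r//; apply: mx_norm_leP => // i j.
by rewrite mxE; exact: mx_coord_norm_le.
Qed.

(** The max norm is attained at an entry, whose square is one term of a sum of squares. *)
Lemma norm_sqr_le_dot v : `|v| ^+ 2 <= dot v v.
Proof.
have dot_ge0 : 0 <= dot v v.
  by rewrite dotE; apply: sumr_ge0 => i _; rewrite -expr2 sqr_ge0.
have [v0|/mx_norm_neq0[[i j] /= vE]] := eqVneq (mx_norm v) 0.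
  by rewrite [`|v|]v0 expr0n.
rewrite [`|v|]vE real_normK ?num_real// ord1 dotE (bigD1 i)//= -expr2 lerDl.
by apply: sumr_ge0 => k _; rewrite -expr2 sqr_ge0.
Qed.

Lemma dot_gt0 v : v != 0 -> 0 < dot v v.
Proof.
by move=> v0; apply: lt_le_trans (norm_sqr_le_dot v); rewrite exprn_gt0 ?normr_gt0.
Qed.

Lemma cvg_dot (T : Type) (F : set_system T) {FF : Filter F}
    (u_ v_ : T -> 'cV[R]_p) (u v : 'cV[R]_p) :
  u_ @ F --> u -> v_ @ F --> v -> dot (u_ x) (v_ x) @[x --> F] --> dot u v.
Proof.
move=> uu vv.
have uuT : (u_ x)^T @[x --> F] --> u^T by apply: cvg_comp uu (@trmx_continuous _ _ _ u).
exact: cvg_comp (cvg_mulmx uuT vv) (@coord_continuous _ _ _ _ _ (u^T *m v)).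
Qed.

End DotProduct.

Section TangentCone.
Variables (R : realType) (p : nat) (C : set 'cV[R]_p) (ybar : 'cV[R]_p).
Implicit Types y v w z : 'cV[R]_p.

(** The pair [t], [w'] stands for one index of the defining sequences, with [w'] the quotient of y_j
    - ybar by t_j. Conversely, the choices made for e = 1/(j+1) form such sequences. *)
Lemma tangent_coneP w : tangent_cone C ybar w <-> forall e : R, 0 < e ->
  exists t w', [/\ 0 < t, t < e, `|w - w'| < e & C (ybar + t *: w')].
Proof.
split=> [[y [t [Cy yy t0 tt0 ytw]]] e e0|wP].
  near \oo => j; exists (t j), ((t j)^-1 *: (y j - ybar)); split.
  - exact: t0.
  - near: j; have /cvgr0Pnorm_lt /(_ _ e0) := tt0.
    by apply: filterS => j; apply: le_lt_trans; exact: ler_norm.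
  - near: j; by move/cvgrPdist_lt : ytw => /(_ _ e0).
  - by rewrite scalerA divff ?gt_eqF// scale1r addrC subrK.
have {wP} /choice[tw twP] : forall j, exists tw : R * 'cV[R]_p,
    [/\ 0 < tw.1, tw.1 < j.+1%:R^-1, `|w - tw.2| < j.+1%:R^-1
      & C (ybar + tw.1 *: tw.2)].
  move=> j; have [|t [w' []]] := wP j.+1%:R^-1; first by rewrite invr_gt0.
  by exists (t, w').
have tw2 : (tw j).2 @[j --> \oo] --> w.
  by apply: cvg_of_harmonic => j; have [] := twP j.
have tw1 : (tw j).1 @[j --> \oo] --> (0 : R).
  apply: (@cvg_of_harmonic _ R^o) => j; have [t0 tj _ _] := twP j.
  by rewrite sub0r normrN gtr0_norm.
exists (fun j => ybar + (tw j).1 *: (tw j).2), (fun j => (tw j).1); split.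
- by move=> j; have [] := twP j.
- rewrite -[X in _ --> X]addr0 -(scale0r w).
  by apply: cvgD; [exact: cvg_cst|exact: cvgZ].
- by move=> j; have [] := twP j.
- exact: tw1.
- apply: cvg_trans tw2; apply: near_eq_cvg; near=> j.
  have [t0 _ _ _] := twP j.
  by rewrite addrC addKr scalerA mulVf ?gt_eqF// scale1r.
Unshelve. all: by end_near. Qed.

Lemma tangent_cone_closure w :
  (forall e : R, 0 < e -> exists2 w', tangent_cone C ybar w' & `|w - w'| <= e) ->
  tangent_cone C ybar w.
Proof.
move=> wP; apply/tangent_coneP => e e0.
have e20 : 0 < e / 2 by rewrite divr_gt0.
have [w' /tangent_coneP /(_ _ e20) [t [w'' [t0 te ww Cw]]] ww'] := wP _ e20.
exists t, w''; split=> //; first by lra.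
by have := ler_distD w' w w''; lra.
Qed.

(** Dividing the inequality for a regular normal at y_j by t_j and passing to the limit gives
    [dot v w <= e * |w|] for every e. *)
Lemma regular_normal_tangent v w :
  regular_normal_cone C ybar v -> tangent_cone C ybar w -> dot v w <= 0.
Proof.
move=> Nv [y [t [Cy yy t0 tt0 ytw]]].
suff main e : 0 < e -> dot v w <= e * `|w|.
  apply/ler_addgt0Pr => e e0; rewrite add0r.
  have w1 : 0 < `|w| + 1 by rewrite ltr_wpDl.
  apply: le_trans (main (e / (`|w| + 1)) _) _; first by rewrite divr_gt0.
  by rewrite -mulrA ger_pMr// mulrC ler_pdivrMr// mul1r lerDl.
move=> e0; apply: (@ler_cvg_to _ (\oo : set_system nat) _ _
    (fun j => dot v ((t j)^-1 *: (y j - ybar)))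
    (fun j => e * `|(t j)^-1 *: (y j - ybar)|)).
- by apply: cvg_dot => //; exact: cvg_cst.
- by apply: cvgM; [exact: cvg_cst|exact: cvg_norm].
have : \forall j \near \oo, C (y j) -> dot v (y j - ybar) <= e * `|y j - ybar|.
  exact: yy (Nv _ e0).
apply: filterS => j /(_ (Cy j)) vy.
rewrite dotZr normrZ gtr0_norm ?invr_gt0// mulrCA.
by rewrite ler_wpM2l// invr_ge0 ltW.
Qed.

(** For small s > 0 the vector [w + s *: v] is still tangent, so [dot v w] is at most
    [- s * dot v v]. The chosen [s] makes the displacement have norm e/2. *)
Lemma regular_normal_interior v w : regular_normal_cone C ybar v -> v != 0 ->
  (tangent_cone C ybar)° w -> dot v w < 0.
Proof.
move=> Nv v0 /nbhs_ballP[e /= e0 we].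
have v0' : 0 < `|v| by rewrite normr_gt0.
pose s := e / 2 / `|v|.
have s0 : 0 < s by rewrite !divr_gt0.
have : tangent_cone C ybar (w + s *: v).
  apply: we; rewrite -ball_normE /= opprD addNKr normrN normrZ gtr0_norm//.
  by rewrite divfK ?gt_eqF// ltr_pdivrMr// ltr_pMr// ltr1n.
move=> /(regular_normal_tangent Nv); rewrite dotDr dotZr.
have := mulr_gt0 s0 (dot_gt0 v0); lra.
Qed.

End TangentCone.

(** * Projections, normals and feasible directions of closed sets *)

Section InteriorTangent.
Variables (R : realType) (p : nat).
Implicit Types (C : set 'cV[R]_p) (v w y z ybar : 'cV[R]_p).

Lemma dot_dist_continuous z : continuous (fun y : 'cV[R]_p => dot (z - y) (z - y)).
Proof.
move=> y; have Fy := nbhs_filter y.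
have zy : (fun x => z - x) @ nbhs y --> z - y.
  exact: (@cvgB _ _ _ (nbhs y) Fy (fun=> z) id z y (cvg_cst _) cvg_id).
exact: (@cvg_dot _ _ _ (nbhs y) Fy _ _ _ _ zy zy).
Qed.

Lemma euclidean_projection C z : closed C -> C !=set0 ->
  exists2 q, C q & forall y, C y -> dot (z - q) (z - q) <= dot (z - y) (z - y).
Proof.
move=> Ccl [y0 Cy0]; pose g y := dot (z - y) (z - y).
have g_cont : continuous g by exact: dot_dist_continuous.
pose K := C `&` g @^-1` [set r | r <= g y0].
have K0 : K !=set0 by exists y0; split=> //=.
have Kc : compact K.
  apply: bounded_closed_compact_cV.
    (* On [K] the square of |z - y| is at most [g y0], hence |z - y| is at most [g y0 + 1]. *)
    exists (`|z| + (g y0 + 1)); split; first exact: num_real.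
    move=> c cb y [_ /= gy]; apply: le_trans (ltW cb).
    have -> : y = z - (z - y) by rewrite subKr.
    apply: le_trans (ler_normB _ _) _; rewrite lerD2l.
    have := le_trans (norm_sqr_le_dot (z - y)) gy; rewrite -/(g _).
    have := normr_ge0 (z - y); nra.
  apply: closedI => //; apply: closed_comp; last exact: closed_le.
  by move=> y _; exact: g_cont.
have [|q /set_mem[Cq gq] qmin] := compact_EVT_min K0 Kc (f := g).
  exact: continuous_subspaceT.
exists q => // y Cy; have [gy|gy] := leP (g y) (g y0).
  by apply: qmin; rewrite inE; split.
exact: le_trans gq (ltW gy).
Qed.

(** With u = z - q and v = y - q, minimality expands to 2 u.v <= v.v. The right side is at most p
    |v|^2, hence at most e |v| once |v| <= e/(p+1). *)
Lemma projection_regular_normal C z q : C q ->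
  (forall y, C y -> dot (z - q) (z - q) <= dot (z - y) (z - y)) ->
  regular_normal_cone C q (z - q).
Proof.
move=> Cq qmin e e0.
have d0 : 0 < e / (p%:R + 1) by rewrite divr_gt0// ltr_wpDl.
apply/nbhs_ballP; exists (e / (p%:R + 1)) => // y.
rewrite -ball_normE => /ltW /= qy Cy.
rewrite -/(dot (z - q) (y - q)).
have := qmin _ Cy; have -> : z - y = (z - q) - (y - q).
  by rewrite opprB addrA subrK.
rewrite distrC in qy; move: (z - q) (y - q) qy => u v ve.
rewrite dot_sqrD dotNl !dotNr => uv.
have vv : dot v v <= p%:R * (`|v| * `|v|).
  by apply: le_trans (dot_norm_le _ _); exact: ler_norm.
have v0 := normr_ge0 v.
have pv : (p%:R + 1) * `|v| <= e by rewrite mulrC -ler_pdivlMr// ltr_wpDl.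
have vv' : dot v v <= e * `|v|.
  by apply: le_trans vv _; rewrite mulrA ler_wpM2r//; lra.
have ev : 0 <= e * `|v| by rewrite mulr_ge0// ltW.
lra.
Qed.

Lemma regular_normal_coneZ C y a v : 0 < a ->
  regular_normal_cone C y v -> regular_normal_cone C y (a *: v).
Proof.
move=> a0 Nv e e0; have := Nv (e / a) (divr_gt0 e0 a0).
apply: filterS => x; rewrite -!/(dot _ _) dotZl.
by rewrite mulrAC ler_pdivlMr// mulrC.
Qed.

(** Otherwise there are points tending to [ybar], directions tending to [w] and regular normals with
    positive products. These normals are nonzero; scaled to norm 1 they subconverge to a unit normal
    at [ybar] whose product with [w] is nonnegative. *)
Lemma normal_cone_neg_nbhs C ybar w :
  (forall v, normal_cone C ybar v -> v != 0 -> dot v w < 0) ->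
  exists2 r, 0 < r & forall y v w', C y -> `|ybar - y| < r -> `|w - w'| < r ->
    regular_normal_cone C y v -> dot v w' <= 0.
Proof.
move=> Nneg; apply: contrapT => Nr.
have /choice[s sP] : forall j : nat, exists s : 'cV[R]_p * 'cV[R]_p * 'cV[R]_p,
    [/\ C s.1.1, `|ybar - s.1.1| < j.+1%:R^-1, `|w - s.2| < j.+1%:R^-1,
       regular_normal_cone C s.1.1 s.1.2 & dot s.1.2 s.2 > 0].
  move=> j; apply: contrapT => Ns; apply: Nr; exists j.+1%:R^-1.
    by rewrite invr_gt0.
  move=> y v w' Cy yy ww Nv; rewrite leNgt; apply/negP => vw.
  by apply: Ns; exists (y, v, w').
pose y_ j := (s j).1.1; pose w_ j := (s j).2.
pose v_ j := `|(s j).1.2|^-1 *: (s j).1.2.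
have v0 j : (s j).1.2 != 0.
  have [_ _ _ _] := sP j; apply: contraTneq => ->.
  by rewrite -leNgt /dot trmx0 mul0mx mxE.
have v1 j : `|v_ j| = 1.
  rewrite /v_ normrZ normrV ?unitfE ?normr_eq0// normr_id mulVf//.
  by rewrite normr_eq0.
have [phi phi_ge [v vv]] : exists2 phi : nat -> nat, (forall k, (k <= phi k)%N) &
    exists l : 'cV[R]_p, v_ \o phi @ \oo --> l.
  by apply: (@bounded_subseq _ _ _ 1) => j; rewrite v1.
have phioo := cvg_ge_id phi_ge.
have yy : y_ \o phi @ \oo --> ybar.
  apply: (cvg_comp _ _ phioo); apply: cvg_of_harmonic => j.
  by have [] := sP j.
have ww : w_ \o phi @ \oo --> w.
  apply: (cvg_comp _ _ phioo); apply: cvg_of_harmonic => j.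
  by have [] := sP j.
have Nv : normal_cone C ybar v.
  exists (y_ \o phi), (v_ \o phi); split=> // j; first by have [] := sP (phi j).
  apply: regular_normal_coneZ; first by rewrite invr_gt0 normr_gt0 v0.
  by have [] := sP (phi j).
have nv : v != 0.
  rewrite -normr_gt0; have -> : `|v| = 1; last exact: ltr01.
  have v1' : (fun j => `|(v_ \o phi) j|) = fun=> 1 by apply/funext => j; exact: v1.
  have v1'' : `|(v_ \o phi) j| @[j --> \oo] --> `|v| by exact: cvg_norm.
  rewrite v1' in v1''; apply/esym.
  exact: (cvg_unique (@Rhausdorff R) (cvg_cst _) v1'').
have := Nneg _ Nv nv; rewrite ltNge => /negP; apply.
apply: (cvgr_to_ge (cvg_dot vv ww)); near=> j => /=.
rewrite /v_ dotZl mulr_ge0// ?invr_ge0// ltW//.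
by have [] := sP (phi j).
Unshelve. all: by end_near. Qed.

(* The squared distance g to C along s |-> ybar + s w' satisfies
   g (s + h) <= g s + O(h^2), because the normal produced by the projection makes
   a nonpositive product with w'. Cutting [0, t] into N steps gives
   g t = O(1/N), so g t = 0. *)
Lemma normal_cone_neg_feasible C ybar w : closed C -> C ybar ->
  (forall v, normal_cone C ybar v -> v != 0 -> dot v w < 0) ->
  exists2 d, 0 < d & forall t w', 0 < t -> t < d -> `|w - w'| < d ->
    C (ybar + t *: w').
Proof.
move=> Ccl Cy /normal_cone_neg_nbhs[r r0 rP].
have /choice[P PP] : forall z, exists q, C q /\
    forall y, C y -> dot (z - q) (z - q) <= dot (z - y) (z - y).
  by move=> z; have [|q Cq qmin] := @euclidean_projection C z Ccl;
    [exists ybar|exists q].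
pose g z := dot (z - P z) (z - P z).
(* For z = ybar + s w' with s <= t, [P z] is within (p+1) s |w'| of z and z within s |w'| of [ybar].
   As |w'| <= |w| + 1, [P z] is within [t * c] of [ybar], and [t < r / c] keeps it in the ball where
   the normals are controlled. *)
pose c : R := (p%:R + 2) * (`|w| + 1).
have c0 : 0 < c by rewrite mulr_gt0// ltr_wpDl.
have wc : (p%:R + 2) * (`|w| + 1) = c by [].
exists (Num.min r (Num.min 1 (r / c))).
  by rewrite !lt_min r0 ltr01 divr_gt0.
move=> t w' t0; rewrite !lt_min => /and3P[tr t1 trc] /and3P[wr w1 _].
have w'w : `|w'| <= `|w| + 1.
  have := ler_normB w (w - w'); rewrite subKr; lra.
pose W := dot w' w'.
have W0 : 0 <= W by apply: le_trans (norm_sqr_le_dot w'); rewrite exprn_ge0.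
have near_P s : 0 <= s -> s <= t -> `|ybar - P (ybar + s *: w')| < r.
  move=> s0 st; set z := ybar + s *: w'.
  have gz : g z <= s ^+ 2 * W.
    have [_ /(_ _ Cy)] := PP z; rewrite -/(g z) => /le_trans; apply.
    by rewrite {1 2}/z addrC addrA addNr add0r dotZl dotZr mulrA expr2.
  have zP : `|z - P z| <= (p%:R + 1) * s * `|w'|.
    have p0 : 0 <= p%:R :> R by [].
    have := norm_sqr_le_dot (z - P z); rewrite -/(g z) => zg.
    have Wle : W <= p%:R * (`|w'| * `|w'|).
      by apply: le_trans (dot_norm_le _ _); exact: ler_norm.
    have n0 := normr_ge0 (z - P z); have n1 := normr_ge0 w'.
    have q0 : 0 <= (p%:R + 1) * s * `|w'| by rewrite !mulr_ge0// addr_ge0.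
    rewrite -(@ler_pXn2r _ 2)//; apply: le_trans zg _; apply: le_trans gz _.
    rewrite !exprMn -mulrA mulrCA ler_wpM2l ?sqr_ge0//.
    apply: le_trans Wle _; rewrite -expr2 ler_wpM2r ?sqr_ge0//; nra.
  have yz : `|ybar - z| <= s * `|w'|.
    by rewrite /z opprD addNKr normrN normrZ ger0_norm.
  have tot : `|ybar - P z| <= (p%:R + 2) * s * `|w'|.
    apply: le_trans (ler_distD z ybar (P z)) _.
    have -> : (p%:R + 2) * s * `|w'| = s * `|w'| + (p%:R + 1) * s * `|w'| by ring.
    exact: lerD.
  apply: le_lt_trans tot _; apply: le_lt_trans (_ : t * c < r); last first.
    by rewrite -ltr_pdivlMr.
  rewrite -wc mulrAC mulrC ler_pM// ?mulr_ge0//.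
  by rewrite ler_wpM2l.
have step s h : 0 <= s -> s <= t -> 0 <= h ->
    g (ybar + (s + h) *: w') <= g (ybar + s *: w') + h ^+ 2 * W.
  move=> s0 st h0; set z := ybar + s *: w'.
  have [CP minP] := PP z.
  have [_ /(_ _ CP)] := PP (ybar + (s + h) *: w'); move=> /le_trans; apply.
  have -> : ybar + (s + h) *: w' - P z = (z - P z) + h *: w'.
    by rewrite scalerDl addrA -/z addrAC.
  have vw : dot (z - P z) w' <= 0.
    apply: (rP (P z)) => //; first exact: near_P.
    exact: projection_regular_normal.
  rewrite dot_sqrD dotZl !dotZr -/(g z) -/W [h * (h * W)]mulrA -expr2.
  have : h * dot (z - P z) w' <= 0 by rewrite mulr_ge0_le0.
  lra.
have g0 : g ybar <= 0.
  by have [_ /(_ _ Cy)] := PP ybar; rewrite subrr {2}/dot mulmx0 mxE.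
have gN (N : nat) : g (ybar + t *: w') <= t ^+ 2 * W / N.+1%:R.
  pose h := t / N.+1%:R.
  have h0 : 0 <= h by rewrite divr_ge0// ltW.
  have tE : t = N.+1%:R * h by rewrite mulrC divfK.
  have main i : (i <= N.+1)%N ->
      g (ybar + (i%:R * h) *: w') <= i%:R * (h ^+ 2 * W).
    elim: i => [_|i IH iN]; first by rewrite !mul0r scale0r addr0.
    have := IH (ltnW iN); rewrite -natr1 !mulrDl !mul1r => gi.
    have iht : i%:R * h <= t by rewrite [leRHS]tE ler_wpM2r// ler_nat ltnW.
    have ih0 : 0 <= i%:R * h by rewrite mulr_ge0.
    by apply: le_trans (step _ _ ih0 iht h0) _; rewrite lerD2r.
  have := main N.+1 (leqnn _); rewrite -tE => /le_trans; apply.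
  rewrite {1}/h; have N0 : N.+1%:R != 0 :> R by [].
  rewrite le_eqVlt; apply/orP; left; apply/eqP; field.
  by rewrite addrC natr1.
have gt0 : g (ybar + t *: w') <= 0.
  have : t ^+ 2 * W / j.+1%:R @[j --> \oo] --> (0 : R).
    rewrite -[X in _ --> X](mulr0 (t ^+ 2 * W)).
    by apply: cvgM; [exact: cvg_cst|exact: cvg_harmonic].
  by move=> /cvgr_to_ge; apply; near=> j; exact: gN.
have [CP _] := PP (ybar + t *: w').
have [zP|zP] := eqVneq (ybar + t *: w' - P (ybar + t *: w')) 0.
  by move/eqP : zP; rewrite subr_eq0 => /eqP ->.
by have := dot_gt0 zP; rewrite -/(g _) ltNge gt0.
Unshelve. all: by end_near. Qed.

End InteriorTangent.

(** * Tangent cones of Clarke regular sets as polars of normal cones *)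

Section ClarkeRegular.
Variables (R : realType) (p : nat) (C : set 'cV[R]_p) (ybar w0 : 'cV[R]_p).
Hypotheses (C_closed : closed C) (C_ybar : C ybar)
  (C_regular : clarke_regular C ybar) (Tw0 : (tangent_cone C ybar)° w0).
Implicit Types v w : 'cV[R]_p.

(** The product of [w] with a normal may vanish. Adding [s *: w0] makes it negative for all nonzero
    normals: by regularity they are regular normals, and [w0] is interior to the tangent cone. *)
Lemma polar_normal_feasible w s : 0 < s ->
  (forall v, normal_cone C ybar v -> dot v w <= 0) ->
  exists2 d, 0 < d & forall t w', 0 < t -> t < d -> `|w + s *: w0 - w'| < d ->
    C (ybar + t *: w').
Proof.
move=> s0 Nw; apply: normal_cone_neg_feasible => // v Nv v0.
have : dot v w0 < 0 by apply: regular_normal_interior Tw0; rewrite -?C_regular.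
rewrite dotDr dotZr => vw0; have := Nw _ Nv.
have : s * dot v w0 < 0 by rewrite pmulr_rlt0.
lra.
Qed.

Lemma normal_tangent v w :
  normal_cone C ybar v -> tangent_cone C ybar w -> dot v w <= 0.
Proof. by rewrite C_regular; exact: regular_normal_tangent. Qed.

(** The directions [w + s *: w0] are feasible for short steps, hence tangent, and tend to [w] as s
    tends to 0; the cone is closed. *)
Lemma polar_normal_tangent w :
  (forall v, normal_cone C ybar v -> dot v w <= 0) -> tangent_cone C ybar w.
Proof.
move=> Nw; apply: tangent_cone_closure => e e0.
have w1 : 0 < `|w0| + 1 by rewrite ltr_wpDl.
pose s := e / (`|w0| + 1).
have s0 : 0 < s by rewrite divr_gt0.
exists (w + s *: w0).
  have [d d0 dP] := polar_normal_feasible s0 Nw.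
  apply/tangent_coneP => c c0; exists (Num.min d c / 2), (w + s *: w0).
  have m0 : 0 < Num.min d c by rewrite lt_min d0.
  have m2 : Num.min d c / 2 < Num.min d c by rewrite ltr_pdivrMr// ltr_pMr// ltr1n.
  have [md mc] : Num.min d c <= d /\ Num.min d c <= c by rewrite !ge_min !lexx orbT.
  split; rewrite ?subrr ?normr0//; first by rewrite divr_gt0.
    exact: lt_le_trans mc.
  apply: dP; rewrite ?subrr ?normr0//; first by rewrite divr_gt0.
  exact: lt_le_trans md.
rewrite opprD addNKr normrN normrZ gtr0_norm// /s -mulrA ger_pMr// mulrC.
by rewrite ler_pdivrMr// mul1r lerDl.
Qed.

(** Convexity of the cone: it is a polar, and nonpositive products with a normal add up. *)
Lemma tangent_coneD w1 w2 a : 0 <= a ->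
  tangent_cone C ybar w1 -> tangent_cone C ybar w2 ->
  tangent_cone C ybar (w1 + a *: w2).
Proof.
move=> a0 Tw1 Tw2; apply: polar_normal_tangent => v Nv.
rewrite dotDr dotZr; have := normal_tangent Nv Tw1.
by have := mulr_ge0_le0 a0 (normal_tangent Nv Tw2); lra.
Qed.

End ClarkeRegular.

(** * Subderivatives of regular Lipschitz functions *)

Section Subderivative.
Variables (R : realType) (n : nat) (f : 'cV[R]_n -> R) (xbar : 'cV[R]_n).
Hypothesis f_lipschitz : locally_lipschitz_at f xbar.
Implicit Types w x y : 'cV[R]_n.

Lemma locally_lipschitz_ball : exists L r, [/\ 0 <= L, 0 < r &
  forall x y, `|xbar - x| < r -> `|xbar - y| < r ->
    `|f x - f y| <= L * `|x - y|].
Proof.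
have [L L0 /nbhs_ballP[r /= r0 rP]] : exists2 L : R, 0 <= L &
    \forall z \near (xbar, xbar), `|f z.1 - f z.2| <= L * `|z.1 - z.2|.
  have [M [Mr MP]] := f_lipschitz; exists (Num.max 0 (M + 1)).
    by rewrite le_max lexx.
  by apply: MP; rewrite lt_max ltrDl ltr01 orbT.
exists L, r; split=> // x y xr yr.
by apply: (rP (x, y)); split; rewrite /= -ball_normE.
Qed.

Definition difference_quotient (x w : 'cV[R]_n) (t : R) := (f (x + t *: w) - f x) / t.

(** The constant does not depend on [t], so directions can be perturbed inside the quotient. The
    bounds on t |w| and t |w'| keep both points in the Lipschitz ball. *)
Lemma difference_quotient_lipschitz : exists L r, [/\ 0 <= L, 0 < r &
  forall t w w', 0 < t -> t * `|w| < r -> t * `|w'| < r ->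
    `|difference_quotient xbar w t - difference_quotient xbar w' t|
      <= L * `|w - w'|].
Proof.
have [L [r [L0 r0 rP]]] := locally_lipschitz_ball; exists L, r; split=> //.
move=> t w w' t0 wr w'r; rewrite /difference_quotient -mulrBl.
rewrite opprB addrA subrK normrM normfV (gtr0_norm t0) ler_pdivrMr//.
apply: le_trans (rP _ _ _ _) _.
- by rewrite opprD addNKr normrN normrZ gtr0_norm.
- by rewrite opprD addNKr normrN normrZ gtr0_norm.
by rewrite opprD addrACA subrr add0r -scalerBr normrZ gtr0_norm// mulrCA mulrC.
Qed.

Lemma difference_quotient_bound w : exists c d, 0 < d /\
  forall t, 0 < t -> t < d -> `|difference_quotient xbar w t| <= c.
Proof.
have [L [r [L0 r0 rP]]] := difference_quotient_lipschitz.
have w1 : 0 < `|w| + 1 by rewrite ltr_wpDl.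
exists (L * `|w|), (r / (`|w| + 1)); split; first by rewrite divr_gt0.
move=> t t0; rewrite ltr_pdivlMr// => tr.
have := rP t w 0 t0; rewrite /difference_quotient scaler0 addr0 subrr mul0r.
rewrite !subr0 normr0 mulr0; apply => //.
by apply: le_lt_trans tr; rewrite ler_wpM2l// ?ltW// ltrDl.
Qed.

Lemma nbhs_right0P (P : R -> Prop) : (\forall t \near 0^'+, P t) <->
  exists2 d, 0 < d & forall t, 0 < t -> t < d -> P t.
Proof.
split=> [/nbhs_ballP[d /= d0 dP]|[d d0 dP]].
  exists d => // t t0 td; apply: dP => //.
  by rewrite -ball_normE /= sub0r normrN gtr0_norm.
apply/nbhs_ballP; exists d => // t; rewrite -ball_normE /= sub0r normrN => td t0.
by apply: dP => //; move: td; rewrite gtr0_norm.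
Qed.

Lemma subderivative_lower w a : (a%:E < subderivative f xbar w)%E ->
  exists2 d, 0 < d & forall t, 0 < t -> t < d -> a <= difference_quotient xbar w t.
Proof.
rewrite /subderivative limf_einfE => /ereal_sup_gt[_ [V FV <-] aV].
have /nbhs_right0P[d d0 dP] : \forall t \near 0^'+, V t by exact: FV.
exists d => // t t0 td; rewrite -lee_fin; apply: ltW; apply: lt_le_trans aV _.
by apply: ereal_inf_lbound; exists t => //; exact: dP.
Qed.

Lemma regular_subderivative_upper w a :
  (regular_subderivative f xbar w < a%:E)%E ->
  exists2 d, 0 < d & forall t x, 0 < t -> t < d -> `|xbar - x| < d ->
    difference_quotient x w t <= a.
Proof.
rewrite /regular_subderivative limf_esupE => /ereal_inf_lt[_ [V FV <-] aV].
have [[A B] /= [FA /nbhs_ballP[e /= e0 eB]] ABV] := FV.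
have /nbhs_right0P[d d0 dP] : \forall t \near 0^'+, A t by exact: FA.
exists (Num.min d e); first by rewrite lt_min d0.
move=> t x t0; rewrite !lt_min => /andP[td _] /andP[_ xe].
rewrite -lee_fin; apply: ltW; apply: le_lt_trans aV.
apply: ereal_sup_ubound; exists (t, x) => //.
by apply: ABV; split; [exact: dP|apply: eB; rewrite -ball_normE].
Qed.

Lemma subderivative_fin_num w : subderivative f xbar w \is a fin_num.
Proof.
have [c [d [d0 dP]]] := difference_quotient_bound w.
have Fd : \forall t \near 0^'+, `|difference_quotient xbar w t| <= c.
  by apply/nbhs_right0P; exists d.
rewrite /subderivative limf_einfE fin_numElt; apply/andP; split.
  apply: lt_le_trans (ltNyr (- c)) _; apply: le_ereal_sup_tmp.
  exists (ereal_inf [set (difference_quotient xbar w t)%:E | t in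
    [set t | `|difference_quotient xbar w t| <= c]]).
    by eexists; first exact: Fd.
  apply: le_ereal_inf_tmp => _ [t /= tc <-]; rewrite lee_fin.
  by move: tc; rewrite ler_norml => /andP[].
apply: le_lt_trans (ltry c); apply: ge_ereal_sup => _ [V FV <-].
have [t [Vt tc]] := filter_ex (filterI FV Fd).
apply: ge_ereal_inf; exists (difference_quotient xbar w t)%:E.
  by exists t.
by rewrite lee_fin; apply: le_trans tc; exact: ler_norm.
Qed.

Hypothesis f_regular : subdifferentially_regular f xbar.

(** Under the Lipschitz hypothesis the subderivative is finite, so [fine] loses no information. *)
Definition dir_deriv w : R := fine (subderivative f xbar w).

Lemma subderivativeE w : subderivative f xbar w = (dir_deriv w)%:E.
Proof. by rewrite fineK// subderivative_fin_num. Qed.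

Lemma difference_quotient_ge w e : 0 < e -> exists2 d, 0 < d &
  forall t, 0 < t -> t < d -> dir_deriv w - e <= difference_quotient xbar w t.
Proof.
by move=> e0; apply: subderivative_lower; rewrite subderivativeE lte_fin ltrBlDr ltrDl.
Qed.

(** Regularity turns a lower limit at [xbar] into an upper bound that is uniform over base points
    near [xbar]. *)
Lemma difference_quotient_le w e : 0 < e -> exists2 d, 0 < d &
  forall t x, 0 < t -> t < d -> `|xbar - x| < d ->
    difference_quotient x w t <= dir_deriv w + e.
Proof.
move=> e0; apply: regular_subderivative_upper; rewrite -f_regular.
by rewrite subderivativeE lte_fin ltrDl.
Qed.

(** Directional differentiability along moving directions: the lower and upper bounds control the
    quotient for [w] itself up to e/2, and the Lipschitz estimate replaces [w] by [w'] at the cost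
    of another e/2. *)
Lemma dir_deriv_approx w e : 0 < e -> exists2 d, 0 < d &
  forall t w', 0 < t -> t < d -> `|w - w'| < d ->
    `|difference_quotient xbar w' t - dir_deriv w| <= e.
Proof.
move=> e0; have e20 : 0 < e / 2 by rewrite divr_gt0.
have [d1 d10 d1P] := difference_quotient_ge w e20.
have [d2 d20 d2P] := difference_quotient_le w e20.
have [L [r [L0 r0 rP]]] := difference_quotient_lipschitz.
have w1 : 0 < `|w| + 1 by rewrite ltr_wpDl.
have L1 : 0 < L + 1 by rewrite ltr_wpDl.
exists (Num.min (Num.min d1 d2) (Num.min (r / (`|w| + 1))
    (Num.min 1 (e / 2 / (L + 1))))).
  by rewrite !lt_min d10 d20 ltr01 !divr_gt0.
move=> t w' t0; rewrite !lt_min => /and4P[/andP[td1 td2] tr _ _].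
move=> /and4P[_ _ ww1 wwe].
have tr' (v : 'cV[R]_n) : `|v| <= `|w| + 1 -> t * `|v| < r.
  move=> vw; apply: le_lt_trans (_ : t * (`|w| + 1) < r).
    by rewrite ler_wpM2l// ltW.
  by rewrite -ltr_pdivlMr.
have w'w : `|w'| <= `|w| + 1.
  by have := ler_normB w (w - w'); rewrite subKr; lra.
have := rP t w w' t0 (tr' _ _) (tr' _ w'w); rewrite lerDl => /(_ ler01) qq.
have Lww : L * `|w - w'| <= e / 2.
  have : (L + 1) * `|w - w'| <= e / 2 by rewrite mulrC -ler_pdivlMr// ltW.
  have := normr_ge0 (w - w'); lra.
have := d1P t t0 td1; have := d2P t xbar t0 td2.
rewrite subrr normr0 => /(_ d20) q2 q1.
have := le_trans qq Lww; rewrite !ler_norml => /andP[]; lra.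
Qed.

Lemma dir_deriv_lipschitz : exists2 L, 0 <= L &
  forall w w', `|dir_deriv w - dir_deriv w'| <= L * `|w - w'|.
Proof.
have [L [r [L0 r0 rP]]] := difference_quotient_lipschitz; exists L => // w w'.
apply/ler_addgt0Pr => e e0; have e20 : 0 < e / 2 by rewrite divr_gt0.
have [d1 d10 d1P] := dir_deriv_approx w e20.
have [d2 d20 d2P] := dir_deriv_approx w' e20.
have w1 : 0 < `|w| + `|w'| + 1 by rewrite ltr_wpDl// addr_ge0.
pose m := Num.min (Num.min d1 d2) (r / (`|w| + `|w'| + 1)).
have m0 : 0 < m by rewrite !lt_min d10 d20 divr_gt0.
have mm : m / 2 < m by rewrite ltr_pdivrMr// ltr_pMr// ltr1n.
have t0 : 0 < m / 2 by rewrite divr_gt0.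
move: mm; rewrite {2}/m !lt_min => /andP[/andP[td1 td2]].
rewrite ltr_pdivlMr// !mulrDr mulr1 => tr.
have tw : 0 <= m / 2 * `|w| by rewrite mulr_ge0// ltW.
have tw' : 0 <= m / 2 * `|w'| by rewrite mulr_ge0// ltW.
have := rP (m / 2) w w' t0; move=> /(_ ltac:(lra) ltac:(lra)) qq.
have := d1P (m / 2) w t0 td1; have := d2P (m / 2) w' t0 td2.
rewrite !subrr !normr0 => /(_ d20) q2 /(_ d10) q1.
move: qq q1 q2; rewrite !ler_norml => /andP[? ?] /andP[? ?] /andP[? ?].
by apply/andP; split; lra.
Qed.

(** The increment over t (w + w') is split at [xbar + t *: w]. The second piece starts away from
    [xbar], which is where uniformity in the base point matters; t |w| < d3 keeps it close
    enough. *)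
Lemma dir_derivD w w' : dir_deriv (w + w') <= dir_deriv w + dir_deriv w'.
Proof.
apply/ler_addgt0Pr => e e0; have e30 : 0 < e / 3 by rewrite divr_gt0.
have [d1 d10 d1P] := difference_quotient_ge (w + w') e30.
have [d2 d20 d2P] := difference_quotient_le w e30.
have [d3 d30 d3P] := difference_quotient_le w' e30.
have w1 : 0 < `|w| + 1 by rewrite ltr_wpDl.
pose m := Num.min (Num.min d1 d2) (Num.min d3 (d3 / (`|w| + 1))).
have m0 : 0 < m by rewrite !lt_min d10 d20 d30 divr_gt0.
have mm : m / 2 < m by rewrite ltr_pdivrMr// ltr_pMr// ltr1n.
have t0 : 0 < m / 2 by rewrite divr_gt0.
move: mm t0; rewrite {2}/m !lt_min; set t := m / 2.
move=> /and3P[/andP[td1 td2] td3]; rewrite ltr_pdivlMr// => tw t0.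
have := d1P t t0 td1; have := d2P t xbar t0 td2; rewrite subrr normr0 => /(_ d20).
have := d3P t (xbar + t *: w) t0 td3; rewrite opprD addNKr normrN normrZ gtr0_norm//.
have -> : t * `|w| < d3 by apply: le_lt_trans tw; rewrite ler_wpM2l// ?ltW// ltrDl.
move=> /(_ isT); rewrite /difference_quotient -addrA -scalerDr.
set A := f _; set B := f _; set D := f _ => q1 q2 q3.
have : (A - B) / t + (B - D) / t = (A - D) / t by ring.
lra.
Qed.

Lemma dir_derivZ a w : 0 < a -> dir_deriv (a *: w) = a * dir_deriv w.
Proof.
move=> a0; apply/eqP; rewrite eq_sym -subr_eq0 -normr_le0.
apply/ler_addgt0Pr => e e0; rewrite add0r.
have e20 : 0 < e / 2 by rewrite divr_gt0.
have ea0 : 0 < e / 2 / a by rewrite divr_gt0.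
have [d1 d10 d1P] := dir_deriv_approx w ea0.
have [d2 d20 d2P] := dir_deriv_approx (a *: w) e20.
pose m := Num.min d2 (d1 / a).
have m0 : 0 < m by rewrite !lt_min d20 divr_gt0.
have mm : m / 2 < m by rewrite ltr_pdivrMr// ltr_pMr// ltr1n.
have t0 : 0 < m / 2 by rewrite divr_gt0.
move: mm t0; rewrite {2}/m !lt_min; set t := m / 2 => /andP[td2].
rewrite ltr_pdivlMr// => td1 t0.
have := d1P (t * a) w (mulr_gt0 t0 a0) td1; rewrite subrr normr0 => /(_ d10) q1.
have := d2P t (a *: w) t0 td2; rewrite subrr normr0 => /(_ d20) q2.
have {q1} : `|a * difference_quotient xbar w (t * a) - a * dir_deriv w| <= e / 2.
  by rewrite -mulrBr normrM gtr0_norm// mulrC -ler_pdivlMr.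
have -> : a * difference_quotient xbar w (t * a) = difference_quotient xbar (a *: w) t.
  rewrite /difference_quotient scalerA; field.
  by rewrite !gt_eqF.
move: q2; rewrite !ler_norml => /andP[? ?] /andP[? ?]; apply/andP; split; lra.
Qed.

End Subderivative.

(** * The robust problem *)

(** Serves proofs by contradiction; [U] collects properties already known for small values, to be
    retained along the sequence. *)
Lemma not_near_right0_seq (R : realType) (P U : R -> Prop) :
  (\forall e \near 0^'+, U e) -> ~ (\forall e \near 0^'+, P e) ->
  exists eps_ : nat -> R, [/\ forall j, 0 < eps_ j, eps_ @ \oo --> 0,
    forall j, U (eps_ j) & forall j, ~ P (eps_ j)].
Proof.
move=> /nbhs_right0P[d d0 dU] NP.
have /choice[eps_ epsP] : forall j : nat, exists e : R,
    [/\ 0 < e, e < j.+1%:R^-1, U e & ~ P e].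
  move=> j; apply: contrapT => Ne; apply: NP; apply/nbhs_right0P.
  exists (Num.min d j.+1%:R^-1); first by rewrite lt_min d0 invr_gt0 ltr0n.
  move=> e e0; rewrite lt_min => /andP[ed ej]; apply: contrapT => NPe.
  by apply: Ne; exists e; split=> //; exact: dU.
exists eps_; split=> [j||j|j].
- by have [] := epsP j.
- apply: (@cvg_of_harmonic _ R^o) => j; have [e0 ej _ _] := epsP j.
  by rewrite sub0r normrN gtr0_norm.
- by have [] := epsP j.
- by have [] := epsP j.
Qed.

Lemma cvg_right0_seq (R : realType) (eps_ : nat -> R) :
  (forall j, 0 < eps_ j) -> eps_ @ \oo --> 0 -> eps_ @ \oo --> 0^'+.
Proof.
move=> e0 ee P NP; have /nbhs_right0P[d d0 dP] : \forall e \near 0^'+, P e by [].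
have /cvgr0Pnorm_lt /(_ _ d0) := ee; apply: filterS => j jd /=.
by apply: dP => //; apply: le_lt_trans jd; exact: ler_norm.
Qed.

Section Robust.
Variables (R : realType) (n m : nat) (k : 'I_m -> nat) (f : 'cV[R]_n -> R)
  (A : forall i : 'I_m, 'M[R]_(k i, n)) (b : forall i : 'I_m, 'cV[R]_(k i))
  (Q : forall i : 'I_m, set 'cV[R]_(k i))
  (dU : forall i : 'I_m, set ('M[R]_(k i, n) * 'cV[R]_(k i)))
  (xbar : 'cV[R]_n).
Arguments Q : clear implicits.
Arguments dU : clear implicits.
Local Notation ybar i := (A i *m xbar - b i).
Local Notation Phi := (nominal_feasible A b Q).
Local Notation robust := (robust_feasible A b Q dU).
Local Notation tangential := (tangential_feasible A b Q dU xbar).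
Local Notation Gamma := (argmin tangential (subderivative f xbar)).
Local Notation D := (dir_deriv f xbar).
Hypotheses (dU0 : forall i, dU i (0, 0))
  (xbar_opt : argmin Phi (EFin \o f) xbar)
  (Q_closed : forall i, closed (Q i))
  (Q_regular : forall i, clarke_regular (Q i) (ybar i))
  (dU_compact : forall i, compact (dU i))
  (Gamma_bounded : bounded_set Gamma)
  (gs : 'cV[R]_n)
  (slater : forall i, (tangent_cone (Q i) (ybar i))° (A i *m gs))
  (f_compactness : forall x_ : nat -> 'cV[R]_n, (forall j, Phi (x_ j)) ->
    f (x_ j) @[j --> \oo] --> f xbar -> x_ @ \oo --> xbar)
  (f_lipschitz : locally_lipschitz_at f xbar)
  (f_regular : subdifferentially_regular f xbar).

Arguments dU0 : clear implicits.
Arguments Q_closed : clear implicits.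
Arguments Q_regular : clear implicits.
Arguments dU_compact : clear implicits.
Arguments slater : clear implicits.

Lemma Phi_xbar : Phi xbar. Proof. by have [] := xbar_opt. Qed.
Arguments Phi_xbar : clear implicits.

Lemma Phi_ge x : Phi x -> f xbar <= f x.
Proof. by have [_ xP] := xbar_opt => /xP; rewrite lee_fin. Qed.

Lemma robustP eps x : robust eps x <-> forall i u, dU i u ->
  Q i (A i *m x - b i + eps *: (u.1 *m x - u.2)).
Proof.
have E i (u : 'M[R]_(k i, n) * 'cV[R]_(k i)) :
    (A i + eps *: u.1) *m x - (b i + eps *: u.2) =
    A i *m x - b i + eps *: (u.1 *m x - u.2).
  by rewrite mulmxDl -scalemxAl scalerBr opprD addrACA.
split=> [Rx i u uU|Rx i _ [u uU <-]]; last by rewrite E; exact: Rx.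
by rewrite -E; apply: (Rx i (eps *: u)); exists u.
Qed.

Lemma robust_nominal eps x : robust eps x -> Phi x.
Proof.
move=> /robustP Rx i; have := Rx i _ (dU0 i).
by rewrite mul0mx subr0 scaler0 addr0.
Qed.

Lemma GammaP g : Gamma g <-> tangential g /\ forall y, tangential y -> D g <= D y.
Proof.
split=> -[Tg gP]; split=> // y /gP.
  by rewrite !subderivativeE.
by rewrite !subderivativeE// lee_fin.
Qed.

Lemma tangential_recession g d a : 0 <= a -> tangential g ->
  (forall i, tangent_cone (Q i) (ybar i) (A i *m d)) -> tangential (g + a *: d).
Proof.
move=> a0 Tg Td i u uU; rewrite mulmxDr -scalemxAr addrAC.
exact: (tangent_coneD (Q_closed i) (Phi_xbar i) (Q_regular i) (slater i) a0
  (Tg i u uU) (Td i)).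
Qed.

(** For each u in [dU i], the constraint at the moved point reads ybar + eps w', where w' tends to w
    + s A_i gs as the perturbation tends to u and eps to 0. Membership thus holds on a neighborhood
    of u for all small eps, and compactness of [dU i] makes the range of eps common to all u. *)
Lemma slater_robust g s : 0 < s -> tangential g ->
  \forall eps \near 0^'+, robust eps (xbar + eps *: (g + s *: gs)).
Proof.
move=> s0 Tg; pose g' := g + s *: gs.
have main i : \forall eps \near 0^'+, forall u, dU i u ->
    Q i (A i *m (xbar + eps *: g') - b i + eps *: (u.1 *m (xbar + eps *: g') - u.2)).
  have FR : Filter (0^'+ : set_system R) by exact: _.
  (* Compactness in near-covering form: it is enough to argue jointly for u' near u and eps near
     0. *)
  have cover := (compact_near_coveringP (dU i)).1 (dU_compact i).
  apply: (cover R _ (fun eps u => Q i (A i *m (xbar + eps *: g') - b i +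
    eps *: (u.1 *m (xbar + eps *: g') - u.2))) FR).
  move=> u uU.
  have Tw := Tg i u uU; set w := A i *m g + _ in Tw.
  have Nw v : normal_cone (Q i) (ybar i) v -> dot v w <= 0.
    by move=> Nv; exact: (normal_tangent (Q_regular i) Nv Tw).
  have [d d0 dP] := polar_normal_feasible (Q_closed i) (Phi_xbar i)
    (Q_regular i) (slater i) s0 Nw.
  pose F := filter_prod (nbhs u) (0^'+ : set_system R).
  pose w' (z : ('M[R]_(k i, n) * 'cV[R]_(k i)) * R) :=
    A i *m g' + (z.1.1 *m xbar - z.1.2) + z.2 *: (z.1.1 *m g').
  have lim : w' @ F --> w + s *: (A i *m gs).
    have -> : w + s *: (A i *m gs) =
        A i *m g' + (u.1 *m xbar - u.2) + 0 *: (u.1 *m g').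
      by rewrite scale0r addr0 /w /g' mulmxDr -scalemxAr addrAC.
    have z1 : z.1 @[z --> F] --> u by exact: cvg_fst.
    have z11 : z.1.1 @[z --> F] --> u.1 by apply: (cvg_comp _ _ z1); exact: cvg_fst.
    have z12 : z.1.2 @[z --> F] --> u.2 by apply: (cvg_comp _ _ z1); exact: cvg_snd.
    have z2 : z.2 @[z --> F] --> (0 : R).
      have : z.2 @[z --> F] --> 0^'+ by exact: cvg_snd.
      by move=> /cvg_trans; apply; exact: cvg_within.
    apply: cvgD; last by apply: cvgZ => //; apply: cvg_mulmx => //; exact: cvg_cst.
    apply: cvgD; first exact: cvg_cst.
    by apply: cvgB => //; apply: cvg_mulmx => //; exact: cvg_cst.
  have F1 : \forall z \near F, `|w + s *: (A i *m gs) - w' z| < d.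
    by move/cvgrPdist_lt : lim => /(_ _ d0).
  have F2 : \forall z \near F, 0 < z.2 /\ z.2 < d.
    have z2 : z.2 @[z --> F] --> 0^'+ by exact: cvg_snd.
    have near_d : \forall e \near (0 : R)^'+, 0 < e /\ e < d.
      by apply/nbhs_right0P; exists d.
    exact: (z2 _ near_d).
  have FF : Filter F by exact: _.
  apply: filterS (filterI F1 F2) => -[u' eps] /= [wd [eps0 epsd]].
  have := dP _ _ eps0 epsd wd; rewrite /w' /=.
  congr (Q i _); rewrite !(mulmxDr _ xbar) -!scalemxAr [_ + _ - b i]addrAC -[RHS]addrA.
  rewrite -scalerDr -[in LHS](addrA (A i *m g')).
  by rewrite [u'.1 *m xbar + _ + _]addrAC.
near=> eps; apply/robustP.
by near: eps; exact: filter_forall.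
Unshelve. all: by end_near. Qed.

(** The constraint point equals ybar + eps_j (A_i g_j + c_j), with g_j the rescaled displacement.
    The term [c_] is the data perturbation for limits of robust points, and 0 for recession
    directions. *)
Lemma tangent_limit (eps_ : nat -> R) (x_ : nat -> 'cV[R]_n) (g : 'cV[R]_n) i
    (c_ : nat -> 'cV[R]_(k i)) (c : 'cV[R]_(k i)) :
  (forall j, 0 < eps_ j) -> eps_ @ \oo --> 0 ->
  (forall j, Q i (A i *m x_ j - b i + eps_ j *: c_ j)) -> c_ @ \oo --> c ->
  ((eps_ j)^-1 *: (x_ j - xbar)) @[j --> \oo] --> g ->
  tangent_cone (Q i) (ybar i) (A i *m g + c).
Proof.
move=> e0 ee Qx cc xg.
have lim : A i *m ((eps_ j)^-1 *: (x_ j - xbar)) + c_ j @[j --> \oo] -->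
    A i *m g + c.
  by apply: cvgD => //; apply: cvg_mulmx => //; exact: cvg_cst.
apply/tangent_coneP => e e0'.
near \oo => j; exists (eps_ j), (A i *m ((eps_ j)^-1 *: (x_ j - xbar)) + c_ j).
split.
- exact: e0.
- near: j; have /cvgr0Pnorm_lt /(_ _ e0') := ee.
  by apply: filterS => j; apply: le_lt_trans; exact: ler_norm.
- by near: j; move/cvgrPdist_lt : lim => /(_ _ e0').
rewrite scalerDr scalemxAr scalerA divff ?gt_eqF// scale1r mulmxBr addrA.
by rewrite (addrC (ybar i)) addrA subrK.
Unshelve. all: by end_near. Qed.

Lemma cvg_directions (eps_ : nat -> R) (x_ : nat -> 'cV[R]_n) (g : 'cV[R]_n) :
  (forall j, 0 < eps_ j) -> eps_ @ \oo --> 0 ->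
  ((eps_ j)^-1 *: (x_ j - xbar)) @[j --> \oo] --> g -> x_ @ \oo --> xbar.
Proof.
move=> e0 ee xg.
have -> : x_ = fun j => xbar + eps_ j *: ((eps_ j)^-1 *: (x_ j - xbar)).
  apply/funext => j; rewrite scalerA divff ?gt_eqF// scale1r addrC.
  by rewrite subrK.
rewrite -[X in _ --> X]addr0 -(scale0r g).
by apply: cvgD; [exact: cvg_cst|exact: cvgZ].
Qed.

Lemma robust_limit_tangential (eps_ : nat -> R) (x_ : nat -> 'cV[R]_n) (g : 'cV[R]_n) :
  (forall j, 0 < eps_ j) -> eps_ @ \oo --> 0 ->
  (forall j, robust (eps_ j) (x_ j)) ->
  ((eps_ j)^-1 *: (x_ j - xbar)) @[j --> \oo] --> g -> tangential g.
Proof.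
move=> e0 ee Rx xg i u uU; have xx := cvg_directions e0 ee xg.
apply: (tangent_limit (c_ := fun j => u.1 *m x_ j - u.2) e0 ee _ _ xg).
  by move=> j; have /robustP := Rx j; exact.
apply: cvgB; last exact: cvg_cst.
by apply: cvg_mulmx => //; exact: cvg_cst.
Qed.

(** The difference quotients along the rescaled displacements converge to [D g], and [a_] bounds
    them from above. *)
Lemma dir_deriv_limit_le (eps_ : nat -> R) (x_ : nat -> 'cV[R]_n) (g : 'cV[R]_n)
    (a_ : nat -> R) (a : R) :
  (forall j, 0 < eps_ j) -> eps_ @ \oo --> 0 ->
  ((eps_ j)^-1 *: (x_ j - xbar)) @[j --> \oo] --> g ->
  (\forall j \near \oo, f (x_ j) <= f xbar + eps_ j * a_ j) ->
  a_ @ \oo --> a -> D g <= a.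
Proof.
move=> e0 ee xg fx aa; apply/ler_addgt0Pr => e epos.
have e20 : 0 < e / 2 by rewrite divr_gt0.
have [d d0 dP] := dir_deriv_approx f_lipschitz f_regular g e20.
near \oo => j.
have ed : eps_ j < d.
  near: j; have /cvgr0Pnorm_lt /(_ _ d0) := ee.
  by apply: filterS => j; apply: le_lt_trans; exact: ler_norm.
have gd : `|g - (eps_ j)^-1 *: (x_ j - xbar)| < d.
  by near: j; move/cvgrPdist_lt : xg => /(_ _ d0).
have ad : `|a - a_ j| < e / 2.
  by near: j; move/cvgrPdist_lt : aa => /(_ _ e20).
have fj : f (x_ j) <= f xbar + eps_ j * a_ j by near: j.
have := dP _ _ (e0 j) ed gd; rewrite /difference_quotient.
rewrite scalerA divff ?gt_eqF// scale1r addrC [xbar + _]addrC subrK.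
move: ad; rewrite distrC => /ltW; rewrite !ler_norml => /andP[_ a1] /andP[a2 _].
have : (f (x_ j) - f xbar) / eps_ j <= a_ j.
  by rewrite ler_pdivrMr// lerBlDl mulrC.
lra.
Unshelve. all: by end_near. Qed.

Lemma robust_value_le g e : tangential g -> 0 < e -> \forall eps \near 0^'+,
  exists2 x, robust eps x & f x <= f xbar + eps * (D g + e).
Proof.
move=> Tg e0; have e20 : 0 < e / 2 by rewrite divr_gt0.
have [L L0 LP] := dir_deriv_lipschitz f_lipschitz f_regular.
have L1 : 0 < L * `|gs| + 1 by rewrite ltr_wpDl// mulr_ge0.
(* The shift along [gs] raises [D] by at most L s |gs| <= e/2; the other half of e pays for the
   difference quotient. *)
pose s := e / 2 / (L * `|gs| + 1).
have s0 : 0 < s by rewrite divr_gt0.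
have [d d0 dP] := dir_deriv_approx f_lipschitz f_regular (g + s *: gs) e20.
near=> eps; exists (xbar + eps *: (g + s *: gs)).
  by near: eps; exact: slater_robust.
have eps0 : 0 < eps by [].
have epsd : eps < d by near: eps; exact: nbhs_right_lt.
have := dP eps (g + s *: gs) eps0 epsd; rewrite subrr normr0 => /(_ d0).
have := LP (g + s *: gs) g.
have -> : g + s *: gs - g = s *: gs by rewrite addrC addKr.
rewrite normrZ (gtr0_norm s0) => Ls.
have Ls' : L * (s * `|gs|) <= e / 2.
  rewrite mulrCA /s -[leLHS]mulrA ger_pMr// mulrC ler_pdivrMr// mul1r.
  by rewrite lerDl.
have := le_trans Ls Ls'; rewrite !ler_norml => /andP[_ q1] /andP[_ q2].
rewrite -lerBlDl mulrC -ler_pdivrMr//; rewrite /difference_quotient in q2.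
move: q1 q2; lra.
Unshelve. all: by end_near. Qed.

Lemma robust_directions_subseq g0 M (eps_ : nat -> R) (x_ : nat -> 'cV[R]_n) :
  Gamma g0 -> (forall j, 0 < eps_ j) -> eps_ @ \oo --> 0 ->
  (forall j, robust (eps_ j) (x_ j)) ->
  (forall j, f (x_ j) <= f xbar + eps_ j * M) ->
  exists2 phi : nat -> nat, (forall j, (j <= phi j)%N) & exists g : 'cV[R]_n,
    ((eps_ (phi j))^-1 *: (x_ (phi j) - xbar)) @[j --> \oo] --> g.
Proof.
move=> /GammaP[Tg0 g0P] e0 ee Rx fx.
pose g_ j := (eps_ j)^-1 *: (x_ j - xbar).
(* Either infinitely many displacements lie in one ball, and compactness applies, or their norms
   tend to infinity, which is refuted below. *)
have [[c cP]|unb] := pselect (exists c : R, forall N, exists2 j, (N <= j)%N & `|g_ j| <= c).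
  have /choice[phi phiP] : forall N, exists j, (N <= j)%N /\ `|g_ j| <= c.
    by move=> N; have [j] := cP N; exists j.
  have [psi psi_ge [g gg]] : exists2 psi : nat -> nat, (forall j, (j <= psi j)%N) &
      exists g : 'cV[R]_n, (g_ \o phi) \o psi @ \oo --> g.
    by apply: (@bounded_subseq _ _ _ c) => j; have [] := phiP j.
  exists (phi \o psi); last by exists g.
  by move=> j; apply: leq_trans (psi_ge j) _; have [] := phiP (psi j).
exfalso.
have /choice[phi phiP] : forall N : nat, exists j, (N <= j)%N /\ N.+1%:R < `|g_ j|.
  move=> N; apply: contrapT => Nj; apply: unb; exists N.+1%:R => N'.
  exists (maxn N N'); first exact: leq_maxr.
  rewrite leNgt; apply/negP => lt; apply: Nj; exists (maxn N N').
  by split=> //; exact: leq_maxl.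
have phi_ge j : (j <= phi j)%N by have [] := phiP j.
have nr j : 0 < `|g_ (phi j)|.
  by have [_] := phiP j; apply: lt_trans; rewrite ltr0n.
pose d_ j := `|g_ (phi j)|^-1 *: g_ (phi j).
have d1 j : `|d_ j| = 1.
  by rewrite /d_ normrZ normrV ?unitfE ?gt_eqF// normr_id mulVf ?gt_eqF.
have [psi psi_ge [d dd]] : exists2 psi : nat -> nat, (forall j, (j <= psi j)%N) &
    exists d : 'cV[R]_n, d_ \o psi @ \oo --> d.
  by apply: (@bounded_subseq _ _ _ 1) => j; rewrite d1.
have d1' : `|d| = 1.
  have d1'' : (fun j => `|(d_ \o psi) j|) = fun=> 1 by apply/funext => j; exact: d1.
  have dd' : `|(d_ \o psi) j| @[j --> \oo] --> `|d| by exact: cvg_norm.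
  rewrite d1'' in dd'; apply/esym.
  exact: (cvg_unique (@Rhausdorff R) (cvg_cst _) dd').
(* The points are nominally feasible and their values lie between [f xbar] and
   [f xbar + eps_ j * M], so the compactness hypothesis applies. *)
have xx : x_ @ \oo --> xbar.
  apply: f_compactness => [j|]; first exact: robust_nominal (Rx j).
  apply: (@squeeze_cvgr _ _ _ _ (fun=> f xbar) (fun j => f xbar + eps_ j * M)).
  - near=> j; rewrite fx andbT; apply: Phi_ge; exact: robust_nominal (Rx j).
  - exact: cvg_cst.
  - rewrite -[X in _ --> X]addr0 -(mul0r M).
    by apply: cvgD; [exact: cvg_cst|apply: cvgM => //; exact: cvg_cst].
pose h j := phi (psi j).
have hoo : h @ \oo --> \oo.
  by apply: cvg_ge_id => j; apply: leq_trans (psi_ge j) (phi_ge _).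
(* This is the distance from the point to [xbar]. Used as scale in place of [eps_], it gives
   displacements with the unit limit [d]. *)
pose r_ j := eps_ (h j) * `|g_ (h j)|.
have gh j : 0 < `|g_ (h j)| by exact: nr.
have r0 j : 0 < r_ j by rewrite mulr_gt0.
have rE j : r_ j = `|x_ (h j) - xbar|.
  rewrite /r_ /g_ normrZ gtr0_norm ?invr_gt0// mulrA divff ?mul1r//.
  by rewrite gt_eqF.
have rr : r_ @ \oo --> 0.
  have -> : r_ = fun j => `|x_ (h j) - xbar| by apply/funext.
  rewrite -(normr0 'cV[R]_n) -(subrr xbar); apply: cvg_norm.
  by apply: cvgB; [exact: (cvg_comp _ _ hoo xx)|exact: cvg_cst].
have xd : (r_ j)^-1 *: (x_ (h j) - xbar) @[j --> \oo] --> d.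
  apply: cvg_trans dd; apply: near_eq_cvg; near=> j.
  by rewrite /= /d_ /g_ scalerA /r_ invfM mulrC.
have Td i : tangent_cone (Q i) (ybar i) (A i *m d).
  rewrite -[A i *m d]addr0.
  apply: (tangent_limit (c_ := fun=> 0) r0 rr _ (cvg_cst _) xd) => j.
  by rewrite scaler0 addr0; exact: robust_nominal (Rx _) i.
have Dd : D d <= 0.
  (* At the scale [r_] the excess [eps * M] becomes [r * (M / |g|)], whose factor tends to 0. *)
  apply: (dir_deriv_limit_le r0 rr xd (a_ := fun j => M / `|g_ (h j)|)).
    near=> j; apply: le_trans (fx _) _; rewrite lerD2l /r_ -mulrA.
    by rewrite [`|_| * (M / _)]mulrC divfK// gt_eqF.
  rewrite -(mulr0 M); apply: cvgM; first exact: cvg_cst.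
  apply: (@cvg_of_harmonic _ R^o) => j; rewrite sub0r normrN gtr0_norm ?invr_gt0//.
  rewrite ltf_pV2 ?posrE ?ltr0n//.
  have [_] := phiP (psi j); apply: le_lt_trans.
  by rewrite ler_nat ltnS.
have [c [_ cP]] := Gamma_bounded.
(* As |d| = 1, the norm of [g0 + s *: d] is at least s - |g0| = |c| + 2, beyond the bound |c| + 1
   valid on Gamma. *)
pose s := `|c| + 2 + `|g0|.
have s0 : 0 < s by rewrite /s; have := normr_ge0 c; have := normr_ge0 g0; lra.
have /(cP (`|c| + 1)) : Gamma (g0 + s *: d).
  apply/GammaP; split; first by apply: tangential_recession => //; exact: ltW.
  move=> y /g0P; apply: le_trans; apply: le_trans (dir_derivD f_lipschitz f_regular _ _) _.
  by rewrite gerDl dir_derivZ// mulr_ge0_le0// ltW.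
rewrite (le_lt_trans (ler_norm c)) ?ltrDl// => /(_ isT) /=.
have : s <= `|g0 + s *: d| + `|g0|.
  have := ler_normB (g0 + s *: d) g0.
  have -> : g0 + s *: d - g0 = s *: d by rewrite addrC addKr.
  by rewrite normrZ d1' mulr1 gtr0_norm.
by rewrite /s; lra.
Unshelve. all: by end_near. Qed.

(** Optimality of x_j is tested against the robust points that follow a tangential y up to an error
    e, which gives [D g <= D y + e]. *)
Lemma optimal_limit_Gamma (eps_ : nat -> R) (x_ : nat -> 'cV[R]_n) (g : 'cV[R]_n) :
  (forall j, 0 < eps_ j) -> eps_ @ \oo --> 0 ->
  (forall j, argmin (robust (eps_ j)) (EFin \o f) (x_ j)) ->
  ((eps_ j)^-1 *: (x_ j - xbar)) @[j --> \oo] --> g -> Gamma g.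
Proof.
move=> e0 ee opt xg; apply/GammaP; split.
  by apply: robust_limit_tangential e0 ee _ xg => j; have [] := opt j.
move=> y Ty; apply/ler_addgt0Pr => e epos.
apply: (dir_deriv_limit_le e0 ee xg _ (cvg_cst _)).
have er := cvg_right0_seq e0 ee.
have : \forall j \near \oo, exists2 x, robust (eps_ j) x &
    f x <= f xbar + eps_ j * (D y + e) by exact: er (robust_value_le Ty epos).
apply: filterS => j [x Rx]; apply: le_trans.
by have [_ /(_ _ Rx)] := opt j; rewrite lee_fin.
Qed.

(** Robust points violating the bound for a sequence of eps tending to 0 would have a subsequential
    limit direction g', feasible for the tangential problem, with [D g' <= D g - e]. *)
Lemma robust_value_ge g e : Gamma g -> 0 < e -> \forall eps \near 0^'+,
  forall x, robust eps x -> f xbar + eps * (D g - e) <= f x.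
Proof.
move=> Gg epos; have UT : \forall e \near (0 : R)^'+, True by near=> e0.
apply: contrapT => /(not_near_right0_seq UT).
move=> [eps_ [e0 ee _ epsP]].
have /choice[x_ xP] : forall j, exists x, robust (eps_ j) x /\
    f x <= f xbar + eps_ j * (D g - e).
  move=> j; have /existsNP[x /not_implyP[Rx /negP]] := epsP j.
  by rewrite -ltNge => /ltW fx; exists x.
have [phi phi_ge [g' xg]] : exists2 phi : nat -> nat, (forall j, (j <= phi j)%N) &
    exists g' : 'cV[R]_n,
      ((eps_ (phi j))^-1 *: (x_ (phi j) - xbar)) @[j --> \oo] --> g'.
  by apply: (robust_directions_subseq Gg e0 ee (M := D g - e)) => j;
    have [] := xP j.
have phioo := cvg_ge_id phi_ge.
have ee' : eps_ \o phi @ \oo --> 0 by exact: (cvg_comp _ _ phioo ee).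
have e0' j : 0 < (eps_ \o phi) j by exact: e0.
have Tg' : tangential g'.
  by apply: (robust_limit_tangential e0' ee' _ xg) => j; have [] := xP (phi j).
have /GammaP[_ /(_ _ Tg')] := Gg; rewrite leNgt => /negP; apply.
have : D g' <= D g - e.
  apply: (dir_deriv_limit_le e0' ee' xg _ (cvg_cst _)).
  by near=> j; have [] := xP (phi j).
by move=> /le_lt_trans; apply; rewrite ltrBlDr ltrDl.
Unshelve. all: by end_near. Qed.

Lemma tangential_optimal_value g : Gamma g ->
  optimal_value tangential (subderivative f xbar) = (D g)%:E.
Proof.
move=> /GammaP[Tg gP]; rewrite /optimal_value; apply/eqP; rewrite eq_le.
apply/andP; split.
  apply: ge_ereal_inf; exists (subderivative f xbar g); first by exists g.
  by rewrite subderivativeE.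
apply: le_ereal_inf_tmp => _ [y Ty <-].
by rewrite subderivativeE// lee_fin; exact: gP.
Qed.

(** The robust value is an infimum, possibly not attained; the upper and lower bounds enclose it,
    which also shows that it is finite. *)
Lemma robust_optimal_value_expansion g e : Gamma g -> 0 < e ->
  \forall eps \near 0^'+, exists2 v, optimal_value (robust eps) (EFin \o f) = v%:E &
    `|v - (f xbar + eps * D g)| <= e * eps.
Proof.
move=> Gg e0; have [Tg _] := Gg.
near=> eps.
have eps0 : 0 < eps by [].
have [x Rx fx] : exists2 x, robust eps x & f x <= f xbar + eps * (D g + e).
  by near: eps; exact: robust_value_le.
have ge y : robust eps y -> f xbar + eps * (D g - e) <= f y.
  by move: y; near: eps; exact: robust_value_ge.
pose V := optimal_value (robust eps) (EFin \o f).
have Vle : (V <= (f xbar + eps * (D g + e))%:E)%E.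
  by apply: ge_ereal_inf; exists (f x)%:E; [exists x|rewrite lee_fin].
have Vge : ((f xbar + eps * (D g - e))%:E <= V)%E.
  by apply: le_ereal_inf_tmp => _ [y Ry <-]; rewrite lee_fin; exact: ge.
have Vfin : V \is a fin_num.
  rewrite fin_numElt (lt_le_trans (ltNyr _) Vge).
  exact: le_lt_trans Vle (ltry _).
exists (fine V); first by rewrite fineK.
rewrite -(fineK Vfin) !lee_fin in Vle Vge.
rewrite ler_norml mulrC; apply/andP; split; lra.
Unshelve. all: by end_near. Qed.

(** Displacements staying away from [g] along a sequence would still have a convergent subsequence,
    whose limit lies in Gamma and is therefore [g]. The bound with [D g + 1] supplies the value
    estimate needed to extract it. *)
Lemma optimal_directions_cvg g (x_ : R -> 'cV[R]_n) : Gamma = [set g] ->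
  (\forall eps \near 0^'+, argmin (robust eps) (EFin \o f) (x_ eps)) ->
  (eps^-1 *: (x_ eps - xbar)) @[eps --> 0^'+] --> g.
Proof.
move=> Geq opt; have Gg : Gamma g by rewrite Geq.
have [Tg _] := Gg.
have U : \forall eps \near 0^'+, argmin (robust eps) (EFin \o f) (x_ eps) /\
    f (x_ eps) <= f xbar + eps * (D g + 1).
  near=> eps.
  have [x Rx fx] : exists2 x, robust eps x & f x <= f xbar + eps * (D g + 1).
    by near: eps; exact: robust_value_le.
  have optx : argmin (robust eps) (EFin \o f) (x_ eps) by near: eps.
  by split=> //; apply: le_trans fx; have [_ /(_ _ Rx)] := optx; rewrite lee_fin.
apply/cvgrPdist_lt => e e0; apply: contrapT => /(not_near_right0_seq U).
move=> [eps_ [eps0 epscvg Ueps far]].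
have [phi phi_ge [g' xg]] : exists2 phi : nat -> nat, (forall j, (j <= phi j)%N) &
    exists g' : 'cV[R]_n,
      ((eps_ (phi j))^-1 *: (x_ (eps_ (phi j)) - xbar)) @[j --> \oo] --> g'.
  apply: (robust_directions_subseq (x_ := x_ \o eps_) (M := D g + 1) Gg) => // j.
    by have [[]] := Ueps j.
  by have [] := Ueps j.
have epscvg' : eps_ \o phi @ \oo --> 0.
  exact: (cvg_comp _ _ (cvg_ge_id phi_ge) epscvg).
have Gg' : Gamma g'.
  apply: (optimal_limit_Gamma (x_ := x_ \o eps_ \o phi) _ epscvg' _ xg) => j.
    exact: eps0.
  by have [] := Ueps (phi j).
have gg' : g' = g by move: Gg'; rewrite Geq.
rewrite gg' in xg.
have /cvgrPdist_lt /(_ _ e0) near_g := xg.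
near \oo => j; apply: (far (phi j)).
by near: j.
Unshelve. all: by end_near. Qed.

End Robust.

Theorem theorem5p3 (R : realType) (n m : nat) (k : 'I_m -> nat)
  (f : 'cV[R]_n -> R)
  (A : forall i : 'I_m, 'M[R]_(k i, n)) (b : forall i : 'I_m, 'cV[R]_(k i))
  (Q : forall i : 'I_m, set 'cV[R]_(k i))
  (dU : forall i : 'I_m, set ('M[R]_(k i, n) * 'cV[R]_(k i)))
  (xbar : 'cV[R]_n)
  (Phi := nominal_feasible A b Q)
  (opt := fun eps : R => argmin (robust_feasible A b Q dU eps) (EFin \o f))
  (vrob := fun eps : R =>
    optimal_value (robust_feasible A b Q dU eps) (EFin \o f))
  (Gamma := argmin (tangential_feasible A b Q dU xbar) (subderivative f xbar))
  (vtilde :=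
    optimal_value (tangential_feasible A b Q dU xbar) (subderivative f xbar))
  (dU0 : forall i, dU i (0, 0))
  (xbar_opt : argmin Phi (EFin \o f) xbar)
  (Q_closed : forall i, closed (Q i))
  (Q_regular : forall i, clarke_regular (Q i) (A i *m xbar - b i))
  (dU_compact : forall i, compact (dU i))
  (dU_convex : forall i, convex_set (dU i))
  (Gamma_bounded : bounded_set Gamma)
  (slater : exists gamma' : 'cV[R]_n, forall i,
    (tangent_cone (Q i) (A i *m xbar - b i))° (A i *m gamma'))
  (f_compactness : forall x_ : nat -> 'cV[R]_n, (forall j, Phi (x_ j)) ->
    f (x_ j) @[j --> \oo] --> f xbar -> x_ @ \oo --> xbar)
  (f_lipschitz : locally_lipschitz_at f xbar)
  (f_regular : subdifferentially_regular f xbar) :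
  [/\ forall (eps_ : nat -> R) (x_ : nat -> 'cV[R]_n),
        (forall j, 0 < eps_ j) -> eps_ @ \oo --> 0 ->
        (forall j, opt (eps_ j) (x_ j)) ->
        cluster (((eps_ j)^-1 *: (x_ j - xbar)) @[j --> \oo]) `<=` Gamma,
      (* Without attainment in the tangential problem the expansion can fail:
         boundedness of Gamma is vacuous when Gamma is empty. *)
      Gamma !=set0 ->
        vtilde \is a fin_num /\
        exists2 r : R -> R, r =o_ (0^'+) (@id R) &
          \forall eps \near 0^'+,
            vrob eps = ((f xbar)%:E + eps%:E * vtilde + (r eps)%:E)%E
    & forall (gammabar : 'cV[R]_n) (x_ : R -> 'cV[R]_n),
        Gamma = [set gammabar] -> (\forall eps \near 0^'+, opt eps (x_ eps)) ->
        (eps^-1 *: (x_ eps - xbar)) @[eps --> 0^'+] --> gammabar /\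
        x_ = (fun eps => xbar + eps *: gammabar) +o_ (0^'+) (@id R)].
Proof.
have [gs slaterP] := slater; split.
- move=> eps_ x_ e0 ee xopt g /cluster_subseq[phi phi_ge xg].
  have ee' : eps_ \o phi @ \oo --> 0.
    exact: (cvg_comp _ _ (cvg_ge_id phi_ge) ee).
  apply: (optimal_limit_Gamma xbar_opt Q_closed Q_regular dU_compact slaterP
    f_lipschitz f_regular _ ee' _ xg) => j; first exact: e0.
  exact: xopt.
- move=> [g Gg].
  have vE : vtilde = (dir_deriv f xbar g)%:E by exact: tangential_optimal_value.
  have expansion := robust_optimal_value_expansion dU0 xbar_opt Q_closed Q_regular
    dU_compact Gamma_bounded slaterP f_compactness f_lipschitz f_regular Gg.
  rewrite vE; split=> //.
  (* [fine] returns the true value only where [vrob] is finite, which the expansion ensures for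
     small eps. *)
  exists (fun eps => fine (vrob eps) - (f xbar + eps * dir_deriv f xbar g)).
    apply/eqoP => e e0; near=> eps.
    have eps0 : 0 < eps by [].
    have [v vrobE ve] : exists2 v, vrob eps = v%:E &
        `|v - (f xbar + eps * dir_deriv f xbar g)| <= e * eps.
      by near: eps; exact: expansion.
    by rewrite vrobE/= (gtr0_norm eps0).
  near=> eps.
  have [v vrobE _] : exists2 v, vrob eps = v%:E &
      `|v - (f xbar + eps * dir_deriv f xbar g)| <= 1 * eps.
    by near: eps; exact: expansion.
  by rewrite vrobE/= -EFinM -!EFinD; congr EFin; ring.
- move=> g x_ Geq xopt.
  have xg := optimal_directions_cvg dU0 xbar_opt Q_closed Q_regular dU_compact
    Gamma_bounded slaterP f_compactness f_lipschitz f_regular Geq xopt.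
  split=> //; apply/eqaddoP => e e0; near=> eps.
  have eps0 : 0 < eps by [].
  have xe : `|g - eps^-1 *: (x_ eps - xbar)| <= e.
    by near: eps; move/cvgrPdist_le : xg; exact.
  (* The remainder is eps times the error of the rescaled displacement, so convergence of the latter
     gives the little-o. *)
  have -> : (x_ - (fun eps => xbar + eps *: g)) eps =
      - (eps *: (g - eps^-1 *: (x_ eps - xbar))).
    rewrite scalerBr scalerA divff ?gt_eqF// scale1r opprB -[RHS]addrA.
    by rewrite -opprD.
  by rewrite normrN normrZ mulrC ler_wpM2r.
Unshelve. all: by end_near. Qed.
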